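(* Let $\mathfrak g$ be a Lie algebra. Every prederivation $p:T^*\mathfrak g\to T^*\mathfrak g$ has the form $$p(x,f)=\big(\alpha(x)+\psi(f),\ \beta(x)+\xi(f)\big)\qquad\text{for all }(x,f)\in T^*\mathfrak g,$$ where $\alpha:\mathfrak g\to\mathfrak g$ is a prederivation of $\mathfrak g$ and $\beta:\mathfrak g\to\mathfrak g^*$, $\psi:\mathfrak g^*\to\mathfrak g$, $\xi:\mathfrak g^*\to\mathfrak g^*$ are linear maps satisfying, for all $x,y,z\in\mathfrak g$ and $f,g\in\mathfrak g^*$, $$\beta\big([x,[y,z]]\big)=-ad^*_{[y,z]}\big(\beta(x)\big)+ad^*_x\Big(ad^*_y\big(\beta(z)\big)-ad^*_z\big(\beta(y)\big)\Big),$$ $$\psi\circ ad^*_x\circ ad^*_y=ad_x\circ ad_y\circ\psi,$$ $$ad^*_x\big(ad^*_{\psi(f)}g-ad^*_{\psi(g)}f\big)=0,$$ $$[\xi,ad^*_x\circ ad^*_y]=ad^*_{\alpha(x)}\circ ad^*_y+ad^*_x\circ ad^*_{\alpha(y)}.$$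
   Context: Lie algebras are real and finite dimensional. A prederivation of a Lie algebra $\mathfrak h$ is a linear map $p:\mathfrak h\to\mathfrak h$ with $p([x,[y,z]])=[p(x),[y,z]]+[x,[p(y),z]]+[x,[y,p(z)]]$ for all $x,y,z\in\mathfrak h$. $ad^*_xf=-f\circ ad_x$ for $x\in\mathfrak g$, $f\in\mathfrak g^*$. $T^*\mathfrak g=\mathfrak g\ltimes\mathfrak g^*$ is the Lie algebra with bracket $[(x,f),(y,g)]=([x,y],\,ad^*_xg-ad^*_yf)$. For endomorphisms, $[A,B]=A\circ B-B\circ A$. *)

(* Defs.v *)
From HB Require Import structures.
From mathcomp Require Import all_boot all_order all_algebra.
From mathcomp Require Import ring.

Set Implicit Arguments.
Unset Strict Implicit.
Unset Printing Implicit Defensive.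

Import GRing.Theory.
Local Open Scope ring_scope.

(* The base [vectType] makes these Lie algebras finite dimensional; dimension 0
   is allowed. *)
HB.mixin Record isLieAlgebra (R : fieldType) V of Vector R V := {
  lie : V -> V -> V;
  lie_linearl : forall y, linear (lie ^~ y);
  lie_linearr : forall x, linear (lie x);
  liexx : forall x, lie x x = 0;
  lie_jacobi : forall x y z,
    lie x (lie y z) + lie y (lie z x) + lie z (lie x y) = 0
}.

#[short(type="lieAlgebraType")]
HB.structure Definition LieAlgebra (R : fieldType) :=
  {V of isLieAlgebra R V & Vector R V}.

Notation "[lie x , y ]" := (lie x y)
  (at level 0, x, y at level 200, format "[lie  x ,  y ]") : ring_scope.

Definition prederivation (R : fieldType) (h : lieAlgebraType R)
    (p : 'End(h)) : Prop :=
  forall x y z : h,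
    p [lie x, [lie y, z]] =
      [lie p x, [lie y, z]] + [lie x, [lie p y, z]] + [lie x, [lie y, p z]].

(* [\o] and [+] have the same precedence, hence the parentheses. *)
Definition lfun_commutator (R : fieldType) (V : vectType R)
    (A B : 'End(V)) : 'End(V) := ((A \o B) - (B \o A))%VF.

Section Adjoint.
Variables (R : fieldType) (g : lieAlgebraType R).
Implicit Types (x y z : g) (f : 'Hom(g, R^o)).

HB.instance Definition _ x :=
  GRing.isLinear.Build R g g *:%R (lie x) (lie_linearr x).

Definition ad x : 'End(g) := linfun (lie x).

Lemma adE x y : ad x y = [lie x, y].
Proof. by rewrite lfunE. Qed.

(* The coadjoint action ad^*_x f = - f o ad_x, on the dual space 'Hom(g, R^o). *)
Definition coad_fun x f : 'Hom(g, R^o) := (- (f \o ad x))%VF.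

Lemma coad_fun_linear x : linear (coad_fun x).
Proof.
move=> a f f'; apply/lfunP => y.
by rewrite !(opp_lfunE, add_lfunE, scale_lfunE, comp_lfunE) opprD scalerN.
Qed.

HB.instance Definition _ x :=
  GRing.isLinear.Build R 'Hom(g, R^o) 'Hom(g, R^o) *:%R (coad_fun x)
    (coad_fun_linear x).

Definition coad x : 'End('Hom(g, R^o)) := linfun (coad_fun x).

Lemma coadE x f : coad x f = (- (f \o ad x))%VF.
Proof. by rewrite lfunE. Qed.

Lemma coadEE x f y : coad x f y = - f [lie x, y].
Proof. by rewrite coadE opp_lfunE comp_lfunE adE. Qed.

Lemma lieDr x y z : [lie x, y + z] = [lie x, y] + [lie x, z].
Proof. exact: linearD. Qed.

Lemma lieNr x y : [lie x, - y] = - [lie x, y].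
Proof. exact: linearN. Qed.

Lemma lieDl x y z : [lie x + y, z] = [lie x, z] + [lie y, z].
Proof. by have := lie_linearl z 1 x y; rewrite !scale1r. Qed.

Lemma lieC x y : [lie x, y] = - [lie y, x].
Proof.
apply/eqP; rewrite -addr_eq0; apply/eqP.
by have := liexx (x + y); rewrite lieDl !lieDr !liexx add0r addr0.
Qed.

Lemma coad_linearl f : linear (fun x => coad x f).
Proof.
move=> a x x'; apply/lfunP => y.
by rewrite add_lfunE scale_lfunE !coadEE lie_linearl linearP opprD scalerN.
Qed.

Lemma coad_lie x y f :
  coad [lie x, y] f = coad x (coad y f) - coad y (coad x f).
Proof.
apply/lfunP => z; rewrite add_lfunE opp_lfunE !coadEE !opprK.
have /eqP := lie_jacobi x y z.
rewrite (lieC z [lie x, y]) (lieC z x) lieNr subr_eq0 => /eqP <-.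
by rewrite linearB opprB.
Qed.

(* T^*g, the semidirect product of g with its dual; the alias keeps its bracket
   (given in [cotangent_lieE]) off the bare product type. *)
Definition cotangent : Type := (g * 'Hom(g, R^o))%type.

HB.instance Definition _ := Vector.copy cotangent (g * 'Hom(g, R^o))%type.

Definition cotangent_lie (u v : cotangent) : cotangent :=
  ([lie u.1, v.1], coad u.1 v.2 - coad v.1 u.2).

Lemma cotangent_lie_linearr u : linear (cotangent_lie u).
Proof.
move=> a v w; rewrite /cotangent_lie /=; congr pair; first exact: lie_linearr.
rewrite linearP (coad_linearl u.2 a v.1 w.1) opprD.
by rewrite addrACA -scalerBr.
Qed.

Lemma cotangent_liexx u : cotangent_lie u u = 0.
Proof. by rewrite /cotangent_lie liexx subrr. Qed.

Lemma cotangent_lie_linearl v : linear (cotangent_lie ^~ v).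
Proof.
move=> a u w; rewrite /cotangent_lie /=; congr pair; first exact: lie_linearl.
rewrite linearP (coad_linearl v.2 a u.1 w.1) opprD.
by rewrite addrACA -scalerBr.
Qed.

Lemma cotangent_jacobi u v w :
  cotangent_lie u (cotangent_lie v w) + cotangent_lie v (cotangent_lie w u)
    + cotangent_lie w (cotangent_lie u v) = 0.
Proof.
case: u v w => [x f] [y f'] [z f'']; rewrite /cotangent_lie /=.
congr pair; first exact: lie_jacobi.
rewrite !linearB /= !coad_lie; apply/lfunP => t.
rewrite !(add_lfunE, opp_lfunE) zero_lfunE.
move: (coad x (coad y f'') t) (coad x (coad z f') t) (coad y (coad z f) t).
move: (coad y (coad x f'') t) (coad z (coad x f') t) (coad z (coad y f) t).
by rewrite /GRing.regular => a b c d e h; ring.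
Qed.

HB.instance Definition _ := isLieAlgebra.Build R cotangent
  cotangent_lie_linearl cotangent_lie_linearr cotangent_liexx cotangent_jacobi.

Lemma cotangent_lieE (x y : g) (f f' : 'Hom(g, R^o)) :
  [lie ((x, f) : cotangent), ((y, f') : cotangent)] =
    ([lie x, y], coad x f' - coad y f).
Proof. by []. Qed.

End Adjoint.

(* Main.v *)
Require Import Defs.
From HB Require Import structures.
From mathcomp Require Import all_boot all_order all_algebra.
From mathcomp Require Import reals.
Import GRing.Theory.
Local Open Scope ring_scope.

(** The maps [alpha], [beta], [psi], [xi] are the four blocks of [p] in the
    decomposition of T^*g as the direct sum of g and its dual
    ([cotangent_block_decomposition]), and every condition on them is one
    component of the prederivation identity at a triple of arguments each lying
    in one of the two summands:
    - at three vectors of g, the components are the prederivation identity of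
      [alpha] and the condition on [beta];
    - at x, y in g and a form f, where [x,[y,f]] = ad^*_x (ad^*_y f), they are
      the condition on [psi] and the one on the commutator of [xi] with
      ad^*_x o ad^*_y;
    - at x in g and two forms f, f', the left-hand side vanishes because the
      dual is an abelian ideal, so the component in the dual says that ad^*_x
      kills ad^*_{psi f} f' - ad^*_{psi f'} f. *)

(** Turns a function proved linear into a morphism; [linfun] alone needs a
    canonical linear structure, which the blocks of [p] below do not carry. *)
Lemma linear_lfunP {R : nzRingType} {U V : vectType R} (F : U -> V) :
  linear F -> exists f : 'Hom(U, V), f =1 F.
Proof.
move=> linF.
pose F' : {linear U -> V} := HB.pack F (GRing.isLinear.Build R U V *:%R F linF).
by exists (linfun F') => x; rewrite (lfunE F').
Qed.

Section Cotangent.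
Variables (R : fieldType) (g : lieAlgebraType R).
Implicit Types (x y : g) (f : 'Hom(g, R^o)) (u v : cotangent g).

Lemma lie0r x : [lie x, 0] = 0.
Proof. exact: linear0. Qed.

Lemma lie0l x : [lie 0, x] = 0.
Proof. by rewrite lieC lie0r oppr0. Qed.

Lemma coad0l f : coad 0 f = 0.
Proof.
by apply/lfunP => y; rewrite coadEE lie0l linear0 oppr0 zero_lfunE.
Qed.

Lemma cotangent_addE u v : u + v = (u.1 + v.1, u.2 + v.2).
Proof. by []. Qed.

(** The blocks are the components of [p (x, 0)] and [p (0, f)]; adding the two
    recovers [p (x, f)]. *)
Lemma cotangent_block_decomposition (p : 'End(cotangent g)) :
  exists (alpha : 'End(g)) (beta : 'Hom(g, 'Hom(g, R^o)))
         (psi : 'Hom('Hom(g, R^o), g)) (xi : 'End('Hom(g, R^o))),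
    forall x f, p (x, f) = (alpha x + psi f, beta x + xi f).
Proof.
have pl a x y : p (a *: x + y, 0) = a *: p (x, 0) + p (y, 0).
  rewrite -linearP; congr (p _); congr pair.
  by rewrite /= scaler0 addr0.
have pr a f f' : p (0, a *: f + f') = a *: p (0, f) + p (0, f').
  rewrite -linearP; congr (p _); congr pair.
  by rewrite /= scaler0 addr0.
have [|alpha alphaE] := @linear_lfunP R g g (fun x => (p (x, 0)).1).
  by move=> a x y; rewrite pl.
have [|beta betaE] :=
    @linear_lfunP R g 'Hom(g, R^o) (fun x => (p (x, 0)).2).
  by move=> a x y; rewrite pl.
have [|psi psiE] :=
    @linear_lfunP R 'Hom(g, R^o) g (fun f => (p (0, f)).1).
  by move=> a f f'; rewrite pr.
have [|xi xiE] :=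
    @linear_lfunP R 'Hom(g, R^o) 'Hom(g, R^o) (fun f => (p (0, f)).2).
  by move=> a f f'; rewrite pr.
exists alpha, beta, psi, xi => x f.
rewrite alphaE betaE psiE xiE -cotangent_addE -linearD /=.
by congr (p _); rewrite cotangent_addE /= addr0 add0r.
Qed.

End Cotangent.

Theorem theorem3p3p1 (R : realType) (g : lieAlgebraType R)
    (p : 'End(cotangent g)) :
  prederivation p ->
  exists (alpha : 'End(g)) (beta : 'Hom(g, 'Hom(g, R^o)))
         (psi : 'Hom('Hom(g, R^o), g)) (xi : 'End('Hom(g, R^o))),
    (forall (x : g) (f : 'Hom(g, R^o)),
        p (x, f) = (alpha x + psi f, beta x + xi f)) /\
    prederivation alpha /\
    (forall x y z : g,
        beta [lie x, [lie y, z]] =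
          - coad [lie y, z] (beta x)
          + coad x (coad y (beta z) - coad z (beta y))) /\
    (forall x y : g,
        (psi \o (coad x \o coad y) = ad x \o (ad y \o psi))%VF) /\
    (forall (x : g) (f f' : 'Hom(g, R^o)),
        coad x (coad (psi f) f' - coad (psi f') f) = 0) /\
    (forall x y : g,
        lfun_commutator xi (coad x \o coad y)%VF =
          ((coad (alpha x) \o coad y) + (coad x \o coad (alpha y)))%VF).
Proof.
move=> pP.
have [alpha [beta [psi [xi pE]]]] := cotangent_block_decomposition _ _ p.
exists alpha, beta, psi, xi; split=> //.
have lieE := (lie0r, lie0l, coad0l, linear0, subr0, sub0r, addr0, add0r).
split=> [x y z|].
  have := pP (x, 0) (y, 0) (z, 0).
  rewrite !(pE, cotangent_lieE) /= !(pE, lieE) !cotangent_addE /= ?lieE.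
  by case.
split=> [x y z|].
  have := pP (x, 0) (y, 0) (z, 0).
  rewrite !(pE, cotangent_lieE) /= !(pE, lieE) !cotangent_addE /= ?lieE.
  move=> -[_ ->].
  by rewrite linearB linearN /= -addrA [X in _ + X]addrC.
split=> [x y|].
  apply/lfunP => f; have := pP (x, 0) (y, 0) (0, f).
  rewrite !(pE, cotangent_lieE) /= !(pE, lieE) !cotangent_addE /= ?lieE.
  move=> -[+ _].
  by rewrite !comp_lfunE !adE.
split=> [x f f'|x y].
  have := pP (x, 0) (0, f) (0, f').
  rewrite !(pE, cotangent_lieE) /= !(pE, lieE) !cotangent_addE /= ?lieE.
  (* The components in g are both 0, so injection yields a single equation. *)
  by case; rewrite -linearD => <-.
apply/lfunP => f; have := pP (x, 0) (y, 0) (0, f).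
rewrite !(pE, cotangent_lieE) /= !(pE, lieE) !cotangent_addE /= ?lieE.
move=> -[_].
rewrite /lfun_commutator !(add_lfunE, opp_lfunE) !comp_lfunE /= => ->.
by rewrite addrK.
Qed.
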